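(* Let $\Phi: M_n(\mathbb{C})\to M_m(\mathbb{C})$ be a linear map that is unital and positive, and let $\Phi^\dagger: M_m(\mathbb{C})\to M_n(\mathbb{C})$ denote its adjoint with respect to the Hilbert-Schmidt inner products. Then for all self-adjoint $H\in M_n(\mathbb{C})$ and all $Y\in M_m^{++}(\mathbb{C})$, $$\mathrm{Tr}\left[\exp\left(H+\log \Phi^\dagger(Y)\right)\right]\ \geq\ \mathrm{Tr}\left[\exp\left(\Phi(H)+\log Y\right)\right].$$
   Context: $M_n(\mathbb{C})$ denotes the $n\times n$ complex matrices, $M_n^{+}(\mathbb{C})$ the subset of positive semidefinite matrices, and $M_n^{++}(\mathbb{C})$ the subset of positive definite matrices. A linear map $\Phi: M_n(\mathbb{C})\to M_m(\mathbb{C})$ is positive if $\Phi(A)\in M_m^{+}(\mathbb{C})$ whenever $A\in M_n^{+}(\mathbb{C})$ (complete positivity is not assumed), and it is unital if $\Phi(I)=I$. Each matrix space carries the Hilbert-Schmidt inner product $\langle A,B\rangle=\mathrm{Tr}[A^*B]$, and $\Phi^\dagger$ is the adjoint of $\Phi$, i.e. $\mathrm{Tr}[\Phi^\dagger(B)^*A]=\mathrm{Tr}[B^*\Phi(A)]$ for all $A\in M_n(\mathbb{C})$, $B\in M_m(\mathbb{C})$. Here $\mathrm{Tr}$ is the usual (unnormalized) matrix trace, and $\exp$ and $\log$ of matrices are the matrix exponential and matrix logarithm.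
   Formalization: Since Φ†(Y) can be singular (e.g. Φ(A)=a₁₁I, n≥2), making log Φ†(Y) undefined, the inequality is stated literally when Φ†(Y) is positive definite, and in all cases with the left side read as the limit, shown to exist, of Tr exp(H+log(Φ†(Y)+εI)) as ε→0+. *)

(* Defs.v *)
From HB Require Import structures.
From mathcomp Require Import all_boot all_order all_algebra.
From mathcomp Require Import spectral.
From mathcomp Require Export complex.
From mathcomp Require Import all_classical all_reals all_analysis.

Set Implicit Arguments.
Unset Strict Implicit.
Unset Printing Implicit Defensive.
Import Order.TTheory GRing.Theory Num.Theory.
Import numFieldNormedType.Exports.
Local Open Scope classical_set_scope.
Local Open Scope ring_scope.
Local Open Scope sesquilinear_scope.
Local Open Scope complex_scope.

Section MatrixNotions.
Variable R : realType.
Implicit Types n m : nat.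

(* The order of R[i] only relates numbers with the same imaginary part, so
   that [0 <= z] and [0 < z] entail that z is real. *)

Definition psdmx n (A : 'M[R[i]]_n) : Prop :=
  A \is hermsymmx /\ forall v : 'cV[R[i]]_n, 0 <= (v^t* *m A *m v) 0 0.

Definition pdmx n (A : 'M[R[i]]_n) : Prop :=
  A \is hermsymmx /\
  forall v : 'cV[R[i]]_n, v != 0 -> 0 < (v^t* *m A *m v) 0 0.

Definition positive_map n m (Phi : 'M[R[i]]_n -> 'M[R[i]]_m) : Prop :=
  forall A, psdmx A -> psdmx (Phi A).

Definition unital_map n m (Phi : 'M[R[i]]_n -> 'M[R[i]]_m) : Prop :=
  Phi 1%:M = 1%:M.

Definition HSdot n (A B : 'M[R[i]]_n) : R[i] := \tr (A^t* *m B).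

Definition is_HSadjoint n m (Phi : 'M[R[i]]_n -> 'M[R[i]]_m)
    (Psi : 'M[R[i]]_m -> 'M[R[i]]_n) : Prop :=
  forall A B, HSdot (Psi B) A = HSdot B (Phi A).

Definition expmx n (A : 'M[R[i]]_n) : 'M[R[i]]_n :=
  limn (series (fun k => k`!%:R^-1 *: A ^+ k)).

(* The logarithm is the functional calculus of [ln] along the spectral
   decomposition [A = P^-1 *m diag_mx D *m P], with P unitary, of a Hermitian
   matrix A.  As [ln] is totalised by [ln x = 0] for [x <= 0], [logmx A] is
   the matrix logarithm only when A is positive definite. *)
Definition logmx n (A : 'M[R[i]]_n) : 'M[R[i]]_n :=
  invmx (spectralmx A)
    *m diag_mx (map_mx (fun z => (ln (complex.Re z))%:C) (spectral_diag A))
    *m spectralmx A.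

(* [Tr_exp_add_log H X t] : t is the value of Tr[exp(H + log X)] for X
   positive semidefinite and possibly singular, log X being -oo on the kernel
   of X, i.e. the limit of Tr[exp(H + log(X + e I))] as e decreases to 0. *)
Definition Tr_exp_add_log n (H X : 'M[R[i]]_n) (t : R[i]) : Prop :=
  (fun e : R => \tr (expmx (H + logmx (X + e%:C%:M))) : R[i]^o) @ 0^'+ --> (t : R[i]^o).

End MatrixNotions.

(* Main.v *)
Require Import Defs.
From mathcomp Require Import all_boot all_order all_algebra.
From mathcomp Require Import spectral.
From mathcomp Require Import all_classical all_reals all_analysis.
From mathcomp Require Import ring lra.

(* Write A = log X, B = log Y, K = H + A and L = Phi H + B, where X >= Phid Y
   (either X = Phid Y or X = Phid Y + e).  The entire function
     F z = Tr[e^(zB/2) Phi(e^(-zA/2) e^(zK) e^(-zA/2)) e^(zB/2) e^((1-z)L)]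
   has F 0 = Tr e^L and F' 0 = 0.  A positive map that is unital, or subunital,
   sends unitaries to contractions (Russo-Dye); applied to Phi this gives
   |F| <= Tr e^L on Re z = 0, and applied to
   W |-> X^(-1/2) Phid(Y^(1/2) W Y^(1/2)) X^(-1/2) it gives |F| <= Tr e^K on
   Re z = 1.  Re F is a bounded harmonic function on the strip, hence
   Re F x <= (1 - x) Tr e^L + x Tr e^K for real x in [0, 1], with equality at 0;
   differentiating at 0 gives 0 <= Tr e^K - Tr e^L.
   The case Phi = id makes Tr e^(H + log X) nondecreasing in X, whence the
   limit defining the trace when Phid Y is singular. *)

Set Implicit Arguments.
Unset Strict Implicit.
Unset Printing Implicit Defensive.
Import Order.TTheory GRing.Theory Num.Theory.
Import numFieldNormedType.Exports.
Local Open Scope ring_scope.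
Local Open Scope sesquilinear_scope.

(** * A discrete three lines theorem for real exponential sums *)

Section ThreeLines.
Variable R : realType.

Lemma sin_le_id (x : R) : `|sin x| <= `|x|.
Proof.
wlog x0 : x / 0 <= x => [hw|].
  have [/hw//|/ltW x0] := leP 0 x.
  by rewrite -normrN -sinN -[`|x|]normrN; apply: hw; rewrite oppr_ge0.
have [|c _] := @MVT_segment R sin cos 0 x x0 (fun y _ => is_derive_sin y).
  by apply: continuous_subspaceT => y; exact: continuous_sin.
rewrite sin0 !subr0 => ->; rewrite normrM ler_piMl//.
exact: cos_max.
Qed.

(** The mean value theorem gives [(cos c - 1) * x], and [1 - cos c = 2 * sin (c / 2) ^+ 2] is at
    most [c]. *)
Lemma sin_sub_id (x : R) : `|sin x - x| <= x ^+ 2.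
Proof.
wlog x0 : x / 0 <= x => [hw|].
  have [/hw//|/ltW x0] := leP 0 x.
  have -> : sin x - x = - (sin (- x) - - x) by rewrite sinN; ring.
  by rewrite normrN -sqrrN; apply: hw; rewrite oppr_ge0.
have [|c] := @MVT_segment R sin cos 0 x x0 (fun y _ => is_derive_sin y).
  by apply: continuous_subspaceT => y; exact: continuous_sin.
rewrite sin0 !subr0 in_itv/= => /andP[c0 cx] ->.
have -> : cos c * x - x = (cos c - 1) * x by ring.
rewrite normrM expr2 (ger0_norm x0) ler_wpM2r//.
have -> : cos c - 1 = - (2 * sin (c / 2) ^+ 2).
  rewrite {1}[c]splitr -mulr2n cos_mulr2n sin2cos2; ring.
rewrite normrN ger0_norm; last by rewrite mulr_ge0// sqr_ge0.
have h1 := sin_le_id (c / 2); have h2 := sin_max (c / 2).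
have : `|sin (c / 2)| * `|sin (c / 2)| <= `|c / 2| * 1 by rewrite ler_pM.
rewrite -expr2 real_normK ?num_real// (@ger0_norm _ (c / 2)) ?divr_ge0//; lra.
Qed.

(** Convexity at [t] and at [- t] gives [1 + t <= expR t <= (1 - t)^-1], and the upper bound is at
    most [1 + t + 2 * t ^+ 2] for [t <= 1 / 2]. *)
Lemma expR_sub_affine (t : R) : `|t| <= 1 / 2 -> `|expR t - 1 - t| <= 2 * t ^+ 2.
Proof.
rewrite ler_norml => /andP[t1 t2].
have h1 := expR_ge1Dx t; have h2 := expR_ge1Dx (- t).
have e0 := expR_gt0 t.
have h3 : expR t * expR (- t) = 1 by rewrite -expRD subrr expR0.
rewrite ger0_norm; last by lra.
have h4 : expR t * (1 - t) <= 1 by rewrite -[leRHS]h3 ler_pM2l.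
have h5 : 1 <= (1 + t + 2 * t ^+ 2) * (1 - t) by nra.
have h6 : expR t * (1 - t) <= (1 + t + 2 * t ^+ 2) * (1 - t).
  exact: le_trans h4 h5.
rewrite ler_pM2r in h6; lra.
Qed.

(* The half-angle formulas make the defect a difference of squares of
   [sinh (t / 2)] and [sin (t / 2)], each of which is close to [t / 2]. *)
Lemma four_point_defect (t : R) : `|t| <= 1 ->
  `|expR t + expR (- t) + 2 * cos t - 4| <= 8 * `|t| ^+ 3.
Proof.
have [s sE] : exists s, t = s + s by exists (t / 2); exact: splitr.
have ns : `|t| = 2 * `|s| by rewrite sE -mulr2n normrMn mulr_natl.
move=> t1; have s1 : `|s| <= 1 / 2 by lra.
pose P := (expR s - expR (- s)) / 2.
have -> : expR t + expR (- t) + 2 * cos t - 4 = 4 * ((P - sin s) * (P + sin s)).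
  rewrite sE opprD !expRD -mulr2n cos_mulr2n /P cos2sin2.
  have : expR s * expR (- s) = 1 by rewrite -expRD subrr expR0.
  set a := expR s; set b := expR (- s); move=> ab.
  have -> : 4 * (((a - b) / 2 - sin s) * ((a - b) / 2 + sin s)) =
    a * a + b * b - 2 * (a * b) - 4 * sin s ^+ 2 by field.
  rewrite ab; ring.
rewrite ns !normrM [`|4|]ger0_norm//.
have h1 : `|P - s| <= 2 * s ^+ 2.
  have := expR_sub_affine s1; have := @expR_sub_affine (- s).
  rewrite normrN sqrrN => /(_ s1).
  rewrite /P !ler_norml => /andP[? ?] /andP[? ?]; apply/andP; split; lra.
have h2 := sin_sub_id s.
have h3 : `|P - sin s| <= 3 * s ^+ 2.
  have -> : P - sin s = (P - s) - (sin s - s) by ring.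
  apply: le_trans (ler_normB _ _) _; lra.
have n2 : s ^+ 2 = `|s| ^+ 2 by rewrite real_normK ?num_real.
have n0 := normr_ge0 s.
have h4 : `|P + sin s| <= 4 * `|s|.
  have -> : P + sin s = (P - s) + s + sin s by ring.
  apply: le_trans (ler_normD _ _) _.
  have := ler_normD (P - s) s; have := sin_le_id s.
  have : s ^+ 2 <= `|s| * (1 / 2) by rewrite n2 expr2 ler_wpM2l.
  lra.
have : `|P - sin s| * `|P + sin s| <= 3 * s ^+ 2 * (4 * `|s|) by rewrite ler_pM.
rewrite n2; set a := _ * _; set q := `|s|; move=> H.
have -> : 8 * (2 * q) ^+ 3 = 64 * (q ^+ 2 * q) by ring.
have : 0 <= q ^+ 2 * q by rewrite mulr_ge0 ?exprn_ge0.
lra.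
Qed.

(** The increments of [T] are nondecreasing, so the first one is at most their average. *)
Lemma discrete_convexity (T : nat -> R) N : (0 < N)%N ->
  (forall j, (0 < j < N)%N -> 2 * T j <= T j.-1 + T j.+1) ->
  N%:R * (T 1%N - T 0%N) <= T N - T 0%N.
Proof.
move=> N0 cvx.
have inc j : (j < N)%N -> T 1%N - T 0%N <= T j.+1 - T j.
  elim: j => [//|j IH jN]; have := IH (ltnW jN).
  have /= := cvx j.+1 jN; lra.
suff h j : (j <= N)%N -> j%:R * (T 1%N - T 0%N) <= T j - T 0%N by exact: h.
elim: j => [|j IH jN]; first by rewrite mul0r subrr.
have := IH (ltnW jN); have := inc j jN; rewrite -[j.+1]addn1 natrD; lra.
Qed.

Section HarmonicSum.
Variables (I : Type) (s : seq I) (mu a b : I -> R).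

(** The real part of [(a k + i b k) exp (mu k (x + i y))], hence harmonic in [x], [y]. *)
Let term k (x y : R) : R :=
  expR (mu k * x) * (a k * cos (mu k * y) - b k * sin (mu k * y)).
Let u x y := \sum_(k <- s) term k x y.

Lemma term_bound k x y : 0 <= x <= 1 ->
  `|term k x y| <= expR `|mu k| * (`|a k| + `|b k|).
Proof.
move=> /andP[x0 x1]; rewrite normrM ler_pM//.
  rewrite ger0_norm ?expR_ge0// ler_expR.
  apply: le_trans (ler_norm _) _; rewrite normrM ler_piMr//.
  by rewrite ger0_norm.
apply: le_trans (ler_normB _ _) _; rewrite !normrM lerD//.
  by rewrite ler_piMr// cos_max.
by rewrite ler_piMr// sin_max.
Qed.

(** The addition formulas make [term k] an eigenfunction of the four-point difference operator; the
    eigenvalue is the defect bounded in [four_point_defect]. *)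
Lemma term_four_point k x y h :
  term k (x + h) y + term k (x - h) y + term k x (y + h) + term k x (y - h)
    - 4 * term k x y =
  term k x y *
    (expR (mu k * h) + expR (- (mu k * h)) + 2 * cos (mu k * h) - 4).
Proof.
rewrite /term !mulrDr !mulrN !expRD !cosD !sinD !cosN !sinN; ring.
Qed.

(** The discrete mean value property of a harmonic function, up to an error of third order in [h]
    whose constant depends on the sum only. *)
Lemma four_point_mean : exists2 C, 0 <= C & forall h x y,
  0 <= h -> (forall k, List.In k s -> `|mu k * h| <= 1) -> 0 <= x <= 1 ->
  4 * u x y <= u (x + h) y + u (x - h) y + u x (y + h) + u x (y - h) + C * h ^+ 3.
Proof.
pose E k := expR `|mu k| * (`|a k| + `|b k|) * (8 * `|mu k| ^+ 3).
exists (\sum_(k <- s) E k).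
  apply: sumr_ge0 => k _.
  by rewrite !mulr_ge0 ?expR_ge0 ?addr_ge0 ?exprn_ge0.
move=> h x y h0 hs x01; rewrite /u !mulr_sumr mulr_suml -!big_split/=.
elim: s hs => [|k s' IH] hs; first by rewrite !big_nil.
rewrite !big_cons lerD//; last by apply: IH => j js; apply: hs; right.
have := term_four_point k x y h.
have := four_point_defect (hs k (or_introl erefl)).
have := term_bound k y x01.
set D := _ + _ - 4; set t := term k x y => ht hD eq.
have : `|t * D| <= E k * h ^+ 3.
  rewrite normrM.
  have -> : E k * h ^+ 3 =
    expR `|mu k| * (`|a k| + `|b k|) * (8 * `|mu k * h| ^+ 3).
    by rewrite /E normrM exprMn (ger0_norm h0); ring.
  by rewrite ler_pM.
rewrite -eq ler_norml => /andP[+ _]; lra.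
Qed.

(* A discrete version of Hadamard's three lines theorem: the four-point
   formula makes [sup_y u (j / N) y] convex in [j] up to a summable error. *)
Lemma three_lines_derivative (c d : R) :
  (forall y, u 0 y <= c) -> (forall y, u 1 y <= d) -> u 0 0 = c ->
  \sum_(k <- s) a k * mu k <= d - c.
Proof.
move=> uc ud u0; have [C C0 four] := four_point_mean.
(* With [N >= W] and [h = 1 / N], every [mu k * h] lies in the range of [expR_sub_affine]; the added
   1 keeps [N] positive. *)
pose W := 2 * (1 + \sum_(k <- s) `|mu k|).
have W0 : 0 <= \sum_(k <- s) `|mu k| by exact: sumr_ge0.
have muW k : List.In k s -> 2 * `|mu k| <= W.
  rewrite /W; elim: s W0 => [//|j s' IH] _ /= [<-|ks]; rewrite big_cons.
    have : 0 <= \sum_(k <- s') `|mu k| by exact: sumr_ge0.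
    lra.
  have h : 0 <= \sum_(k <- s') `|mu k| by exact: sumr_ge0.
  have := IH h ks; have := normr_ge0 (mu j); lra.
pose C2 := \sum_(k <- s) 2 * (`|a k| * mu k ^+ 2).
suff step (N : nat) : W <= N%:R ->
    \sum_(k <- s) a k * mu k <= d - c + (C / 2 + C2) / N%:R.
  apply/ler_addgt0Pr => e e0.
  (* Large enough both for [W <= N] and for the error term to drop below [e]. *)
  pose N := (Num.truncn (W + (C / 2 + C2) / e)).+1.
  have C20 : 0 <= C2.
    by apply: sumr_ge0 => k _; rewrite mulr_ge0// mulr_ge0// sqr_ge0.
  have D0 : 0 <= (C / 2 + C2) / e.
    by rewrite divr_ge0 ?addr_ge0 ?divr_ge0// ltW.
  have NW : W + (C / 2 + C2) / e < N%:R by exact: truncnS_gt.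
  have N0 : 0 < N%:R :> R by rewrite ltr0n.
  apply: le_trans (step N _) _; first by lra.
  rewrite lerD2l ler_pdivrMr//.
  have NW' : (C / 2 + C2) / e <= N%:R by rewrite /W in NW; lra.
  by rewrite [e * _]mulrC -ler_pdivrMr.
move=> NW.
have N0 : 0 < N%:R :> R by apply: lt_le_trans NW; rewrite /W; lra.
have [h hE] : exists h : R, h = N%:R^-1 by exists N%:R^-1.
have Nh : N%:R * h = 1 by rewrite hE mulfV// gt_eqF.
have h0 : 0 < h by rewrite hE invr_gt0.
have muh k : List.In k s -> `|mu k * h| <= 1 / 2.
  move=> /muW mk; rewrite normrM (ger0_norm (ltW h0)).
  rewrite hE ler_pdivrMr//; lra.
pose B := \sum_(k <- s) expR `|mu k| * (`|a k| + `|b k|).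
have uB x y : 0 <= x <= 1 -> u x y <= B.
  move=> x01; apply: ler_sum => k _.
  exact: le_trans (ler_norm _) (term_bound k y x01).
pose S (j : nat) := sup (range (u (j%:R * h))).
have j01 j : (j <= N)%N -> 0 <= j%:R * h <= 1.
  move=> jN; rewrite mulr_ge0 ?(ltW h0)//= -[leRHS]Nh ler_pM2r//.
  by rewrite ler_nat.
have uS j y : (j <= N)%N -> u (j%:R * h) y <= S j.
  move=> jN; apply: ub_le_sup; last by exists y.
  by exists B => _ [z _ <-]; apply: uB; exact: j01.
have Sle j z : (forall y, u (j%:R * h) y <= z) -> S j <= z.
  move=> H; apply: ge_sup; first by exists (u (j%:R * h) 0), 0.
  by move=> _ [y _ <-].
have S0 : S 0%N <= c by apply: Sle => y; rewrite mul0r; exact: uc.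
have SN : S N <= d by apply: Sle => y; rewrite Nh; exact: ud.
have cvx j : (0 < j < N)%N ->
    2 * S j <= S j.-1 + S j.+1 + C * h ^+ 3.
  case: j => [//|j] /andP[_ jN].
  (* The two vertical neighbours of a point stay on its own line, so each contributes at most
     [S j.+1]. *)
  suff : S j.+1 <= (S j + S j.+2 + 2 * S j.+1 + C * h ^+ 3) / 4 by move=> /=; lra.
  apply: Sle => y.
  have H k : List.In k s -> `|mu k * h| <= 1 by move=> /muh; lra.
  have := four h (j.+1%:R * h) y (ltW h0) H (j01 _ (ltnW jN)).
  have -> : j.+1%:R * h + h = j.+2%:R * h by rewrite -[j.+2]addn1 natrD; ring.
  have -> : j.+1%:R * h - h = j%:R * h by rewrite -[j.+1]addn1 natrD; ring.
  have := uS j.+2 y jN; have := uS j y (ltnW (ltnW jN)).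
  have := uS j.+1 (y + h) (ltnW jN); have := uS j.+1 (y - h) (ltnW jN).
  lra.
have Npos : (0 < N)%N by rewrite -(ltr0n R).
(* The second difference of [j ^+ 2 / 2] is 1, so adding [C * h ^+ 3] times it absorbs the error and
   leaves a convex sequence. *)
have : N%:R * (S 1%N + C * h ^+ 3 * (1%:R ^+ 2 / 2) - (S 0%N + C * h ^+ 3 * (0%:R ^+ 2 / 2)))
    <= S N + C * h ^+ 3 * (N%:R ^+ 2 / 2) - (S 0%N + C * h ^+ 3 * (0%:R ^+ 2 / 2)).
  apply: (@discrete_convexity (fun j => S j + C * h ^+ 3 * (j%:R ^+ 2 / 2)) N Npos).
  move=> j jN; have := cvx j jN; case: j jN => [//|j] _ /=.
  rewrite -[j.+2]addn2 -[j.+1]addn1 !natrD; lra.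
rewrite !expr0n/= !mul0r !mulr0 addr0 expr1n => conv.
have conv2 : S 1%N - S 0%N + C * h ^+ 3 / 2 <= h * (S N - S 0%N) + C * h ^+ 2 / 2.
  have -> : h * (S N - S 0%N) + C * h ^+ 2 / 2 =
    h * (S N + C * h ^+ 3 * (N%:R ^+ 2 / 2) - S 0%N).
    have -> : C * h ^+ 3 * (N%:R ^+ 2 / 2) = C * h * (N%:R * h) ^+ 2 / 2 by ring.
    by rewrite Nh; ring.
  rewrite -(@ler_pM2l _ N%:R)// [leRHS]mulrA Nh mul1r; lra.
have u1 : u h 0 <= S 1%N by have := uS 1%N 0 Npos; rewrite mul1r.
(* First-order expansion of [u] along the real axis; [C2] collects the quadratic remainders. *)
have lin : h * (\sum_(k <- s) a k * mu k) - C2 * h ^+ 2 <= u h 0 - u 0 0.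
  rewrite /u /C2 mulr_sumr mulr_suml -!sumrB.
  elim: s muh => [|k s' IH] hs; first by rewrite !big_nil.
  rewrite !big_cons lerD//; last by apply: IH => j js; apply: hs; right.
  rewrite /term !mulr0 cos0 sin0 expR0 !mulr0 subr0 mul1r mulr1.
  have hk := expR_sub_affine (hs k (or_introl erefl)).
  have -> : expR (mu k * h) * a k - a k =
    a k * (expR (mu k * h) - 1 - mu k * h) + h * (a k * mu k) by ring.
  have : `|a k * (expR (mu k * h) - 1 - mu k * h)| <=
      `|a k| * (2 * (mu k * h) ^+ 2) by rewrite normrM ler_wpM2l.
  rewrite ler_norml => /andP[+ _]; lra.
(* Convexity bounds [S 1] by [(1 - h) * S 0 + h * S N] up to order [h ^+ 2]; after inserting [c] and
   [d], the claim follows on dividing by [h]. *)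
have S0h : (1 - h) * S 0%N <= (1 - h) * c.
  rewrite ler_wpM2l// subr_ge0.
  by have /andP[_] := j01 1%N Npos; rewrite mul1r.
have SNh : h * S N <= h * d by rewrite ler_pM2l.
have h3 : 0 <= C * h ^+ 3 by rewrite mulr_ge0// exprn_ge0// ltW.
rewrite -hE -(ler_pM2l h0); lra.
Qed.

End HarmonicSum.

End ThreeLines.

(** * Matrices diagonalised by a unitary *)

Section UnitaryDiagonalization.
Variable C : numClosedFieldType.
Implicit Types n m : nat.

(** With [P] unitary, functional calculus amounts to changing [d] while [P] stays fixed. *)
Definition udmx n (P : 'M[C]_n) (d : 'rV[C]_n) : 'M[C]_n :=
  P^t* *m diag_mx d *m P.

Lemma udmxM n (P : 'M[C]_n) d e : P \is unitarymx ->
  udmx P d *m udmx P e = udmx P (\row_j (d 0 j * e 0 j)).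
Proof.
move=> Pu; rewrite /udmx !mulmxA mulmxtVK// -!mulmxA; congr (_ *m _).
rewrite mulmxA mulmx_diag; congr (diag_mx _ *m _).
Qed.

Lemma udmx_rowM n (P : 'M[C]_n) (f g : 'I_n -> C) : P \is unitarymx ->
  udmx P (\row_j f j) *m udmx P (\row_j g j) = udmx P (\row_j (f j * g j)).
Proof.
by move=> Pu; rewrite udmxM//; congr udmx; apply/rowP => j; rewrite !mxE.
Qed.

Lemma udmx1 n (P : 'M[C]_n) : P \is unitarymx -> udmx P (const_mx 1) = 1%:M.
Proof.
move=> Pu; rewrite /udmx diag_const_mx mulmx1 -[LHS]mul1mx mulmxA.
by rewrite mul1mx -invmx_unitary// mulVmx// unitarymx_unit.
Qed.

Lemma trmxCE m n (A : 'M[C]_(m, n)) i j : (A^t*) i j = (A j i)^*.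
Proof. by rewrite mxE mxE. Qed.

Lemma udmx_trC n (P : 'M[C]_n) d : (udmx P d)^t* = udmx P (map_mx Num.conj d).
Proof.
rewrite /udmx !trmx_mul !map_mxM trmxCK mulmxA; congr (_ *m _ *m _).
by rewrite tr_diag_mx map_diag_mx.
Qed.

Lemma mxtrace_udmx n (P : 'M[C]_n) d : P \is unitarymx ->
  \tr (udmx P d) = \sum_j d 0 j.
Proof.
by move=> Pu; rewrite /udmx mxtrace_mulC mulmxA (unitarymxP Pu) mul1mx mxtrace_diag.
Qed.

Lemma udmx_row n (P : 'M[C]_n) (d : 'rV[C]_n) j : P \is unitarymx ->
  (row j P *m udmx P d *m (row j P)^t*) 0 0 = d 0 j.
Proof.
move=> Pu; transitivity ((P *m udmx P d *m P^t*) j j).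
  rewrite -row_mul mxE [RHS]mxE.
  apply: eq_bigr => k _; congr (_ * _); last by rewrite !mxE.
  by rewrite [LHS]mxE.
by rewrite /udmx !mulmxA (unitarymxP Pu) mul1mx mulmxtVK// mxE eqxx mulr1n.
Qed.

Lemma udmxE n (P : 'M[C]_n) d i j :
  udmx P d i j = \sum_k d 0 k * ((P k i)^* * P k j).
Proof.
rewrite /udmx mxE; apply: eq_bigr => k _.
by rewrite mul_mx_diag !mxE; ring.
Qed.

Lemma udmx_unitary n (P : 'M[C]_n) (d : 'rV[C]_n) : P \is unitarymx ->
  (forall j, `|d 0 j| = 1) -> udmx P d \is unitarymx.
Proof.
move=> Pu d1; apply/unitarymxP; rewrite udmx_trC udmxM// -[RHS](udmx1 Pu).
by congr udmx; apply/rowP => j; rewrite !mxE -normCK d1 expr1n.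
Qed.

Lemma normalmx_udmx n (A : 'M[C]_n) : A \is normalmx ->
  A = udmx (spectralmx A) (spectral_diag A).
Proof.
by move=> /orthomx_spectralP {1}->; rewrite invmx_unitary ?spectral_unitarymx.
Qed.

(** A unitary matrix is normal; conjugating [U *m U^t* = 1%:M] back by [P] shows that its
    eigenvalues have modulus 1. *)
Lemma unitarymx_udmx n (U : 'M[C]_n) : U \is unitarymx ->
  exists P d, [/\ P \is unitarymx, U = udmx P d & forall j, `|d 0 j| = 1].
Proof.
move=> Uu; have Un : U \is normalmx.
  apply/normalmxP; rewrite (unitarymxP Uu).
  by rewrite -invmx_unitary// mulVmx// unitarymx_unit.
have := normalmx_udmx Un; have := spectral_unitarymx U.
move: (spectralmx U) (spectral_diag U) => P d Pu UE.
exists P, d; split=> // j.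
have : udmx P (\row_k (d 0 k * (d 0 k)^*)) = udmx P (const_mx 1).
  rewrite (udmx1 Pu) -(unitarymxP Uu) UE udmx_trC (udmxM _ _ Pu).
  by congr udmx; apply/rowP => k; rewrite !mxE.
move=> /(congr1 (fun M => P *m M *m P^t*)).
rewrite /udmx !mulmxA (unitarymxP Pu) !mul1mx -!mulmxA (unitarymxP Pu) !mulmx1.
move=> /matrixP/(_ j j); rewrite !mxE eqxx !mulr1n -normCK => /eqP.
by rewrite sqrp_eq1// => /eqP.
Qed.

(** Spectral resolution: for [P] unitary, [udmx P (delta_mx 0 j)] is a rank-one eigenprojection. *)
Lemma udmx_sum n (P : 'M[C]_n) d :
  udmx P d = \sum_j d 0 j *: udmx P (delta_mx 0 j).
Proof.
apply/matrixP => a b; rewrite udmxE summxE; apply: eq_bigr => j _.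
rewrite mxE udmxE (bigD1 j)//= big1 => [|k kj]; rewrite !mxE.
  by rewrite !eqxx mul1r addr0.
by rewrite (negbTE kj) andbF mul0r.
Qed.

Lemma hermsymmxP n (A : 'M[C]_n) : reflect (A^t* = A) (A \is hermsymmx).
Proof.
by apply: (iffP (is_hermitianmxP _ _ _)); rewrite expr0 scale1r => /esym.
Qed.

End UnitaryDiagonalization.

(** * Positive forms, contractions and the Russo-Dye bound *)

Section Contractions.
Variable C : numClosedFieldType.
Implicit Types n m : nat.

Definition sform n (A : 'M[C]_n) (u v : 'cV[C]_n) : C := (u^t* *m A *m v) 0 0.

(** Convertible with [psdmx] over [R[i]]. *)
Definition psform n (A : 'M[C]_n) := A \is hermsymmx /\ forall v, 0 <= sform A v v.

(** Expresses that the operator norm is at most 1: rescaling [u] and [v] turns the sum of squares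
    into a product of norms. This form needs no square root and adds up over decompositions. *)
Definition contractive n (A : 'M[C]_n) :=
  forall u v, `|sform A u v| *+ 2 <= sform 1%:M u u + sform 1%:M v v.

Lemma sformDl n (A B : 'M[C]_n) u v : sform (A + B) u v = sform A u v + sform B u v.
Proof. by rewrite /sform mulmxDr mulmxDl mxE. Qed.

Lemma sformN n (A : 'M[C]_n) u v : sform (- A) u v = - sform A u v.
Proof. by rewrite /sform mulmxN mulNmx mxE. Qed.

Lemma sform_sum n I (s : seq I) (c : I -> C) (A : I -> 'M[C]_n) u v :
  sform (\sum_(k <- s) c k *: A k) u v = \sum_(k <- s) c k * sform (A k) u v.
Proof.
by rewrite /sform mulmx_sumr mulmx_suml summxE; apply: eq_bigr => k _;
  rewrite -scalemxAr -scalemxAl mxE.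
Qed.

Lemma sform_conj n (A : 'M[C]_n) u v : A \is hermsymmx ->
  sform A v u = (sform A u v)^*.
Proof.
move=> /hermsymmxP Ah; rewrite /sform.
have -> : v^t* *m A *m u = (u^t* *m A *m v)^t*.
  by rewrite !trmx_mul !map_mxM trmxCK Ah mulmxA.
by rewrite !mxE.
Qed.

(** Cauchy-Schwarz with an arithmetic mean on the right: positivity of the form at [u - w *: v],
    with a phase [w] making [w * s] equal to its modulus. *)
Lemma psform_le n (A : 'M[C]_n) u v : psform A ->
  `|sform A u v| *+ 2 <= sform A u u + sform A v v.
Proof.
move=> [Ah Apos]; set s := sform A u v.
have [w [w1 ws]] : exists w : C, w * w^* = 1 /\ w * s = `|s|.
  have [->|s0] := eqVneq s 0; first by exists 1; rewrite rmorph1 !mul1r normr0.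
  exists (s^* / `|s|); split; last first.
    by rewrite mulrAC [_^* * _]mulrC -normCK expr2 mulfK// normr_eq0.
  rewrite -normCK normrM normfV normr_id norm_conjC mulfV ?normr_eq0//.
  by rewrite expr1n.
have w1' : w^* * w = 1 by rewrite mulrC.
have ws' : w^* * s^* = `|s|.
  transitivity ((w * s)^*); first by rewrite rmorphM.
  by rewrite ws conj_Creal// normr_real.
have := Apos (u - w *: v).
have -> : sform A (u - w *: v) (u - w *: v) =
    sform A u u - w * sform A u v - w^* * sform A v u + w^* * w * sform A v v.
  rewrite /sform.
  have -> : (u - w *: v)^t* = u^t* - w^* *: v^t*.
    by apply/matrixP => a b; rewrite !mxE rmorphB rmorphM.
  rewrite !mulmxBl !mulmxBr -!scalemxAl -!scalemxAr !mxE; ring.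
rewrite (sform_conj u v Ah) -/s ws ws' w1' mul1r mulr2n => h.
rewrite -subr_ge0; apply: le_trans h _; rewrite le_eqVlt; apply/orP; left.
by apply/eqP; ring.
Qed.

Lemma udmx_psform n (P : 'M[C]_n) (d : 'rV[C]_n) :
  (forall j, 0 <= d 0 j) -> psform (udmx P d).
Proof.
move=> d0; split.
  apply/hermsymmxP; rewrite udmx_trC; congr udmx; apply/rowP => k.
  by rewrite mxE geC0_conj.
move=> x; rewrite /sform /udmx.
have -> : x^t* *m (P^t* *m diag_mx d *m P) *m x =
   (P *m x)^t* *m diag_mx d *m (P *m x).
  by rewrite trmx_mul map_mxM !mulmxA.
rewrite mxE; apply: sumr_ge0 => k _; rewrite mul_mx_diag mxE.
rewrite trmxCE mulrAC mulr_ge0//.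
by rewrite mulrC mul_conjC_ge0.
Qed.

(** Russo-Dye: [U] combines positive matrices [Q j] with coefficients of modulus 1, [psform_le]
    bounds each [Phi (Q j)], and the [Q j] add up to the identity. *)
Lemma unitary_contraction n m (Phi : {linear 'M[C]_n -> 'M[C]_m}) (U : 'M[C]_n) :
  (forall A, psform A -> psform (Phi A)) -> psform (1%:M - Phi 1%:M) -> U \is unitarymx ->
  contractive (Phi U).
Proof.
move=> Phi_pos Phi1 Uu u v.
have [P [d [Pu UE d1]]] := unitarymx_udmx Uu.
pose Q j := udmx P (delta_mx 0 j).
have Qpos j : psform (Q j) by apply: udmx_psform => k; rewrite mxE ler0n.
have PhiE e : Phi (udmx P e) = \sum_j e 0 j *: Phi (Q j).
  by rewrite udmx_sum linear_sum; apply: eq_bigr => j _; rewrite linearZ.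
have Phi1E x : sform (Phi 1%:M) x x = \sum_j sform (Phi (Q j)) x x.
  rewrite -(udmx1 Pu) PhiE sform_sum; apply: eq_bigr => j _.
  by rewrite mxE mul1r.
have Phi1le x : sform (Phi 1%:M) x x <= sform 1%:M x x.
  by rewrite -subr_ge0 -sformN -sformDl; case: Phi1 => _; apply.
apply: le_trans (lerD (Phi1le u) (Phi1le v)).
rewrite UE PhiE sform_sum !Phi1E -big_split/=.
apply: le_trans (_ : (\sum_j `|sform (Phi (Q j)) u v|) *+ 2 <= _).
  rewrite lerMn2r orbC; apply/orP; left.
  apply: le_trans (ler_norm_sum _ _ _) _.
  by apply: ler_sum => j _; rewrite normrM d1 mul1r.
rewrite -sumrMnl; apply: ler_sum => j _.
by apply: psform_le; apply: Phi_pos.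
Qed.

Lemma mulmx_diagE n (B W1 W2 : 'M[C]_n) j :
  (W1 *m B *m W2) j j = sform B ((row j W1)^t*) (col j W2).
Proof.
rewrite /sform trmxCK -row_mul mxE [RHS]mxE; apply: eq_bigr => k _.
by congr (_ * _); rewrite [RHS]mxE.
Qed.

(** The entry is the form of [B] at two unit vectors, taken from a row of [W1] and a column of
    [W2]. *)
Lemma contractive_unitary_diag n (B W1 W2 : 'M[C]_n) j : contractive B ->
  W1 \is unitarymx -> W2 \is unitarymx -> `|(W1 *m B *m W2) j j| <= 1.
Proof.
move=> Bc W1u W2u; have := Bc ((row j W1)^t*) (col j W2).
rewrite -mulmx_diagE.
have -> : sform 1%:M ((row j W1)^t*) ((row j W1)^t*) = 1.
  have E1 : (W1 *m W1^t*) j j = 1 by rewrite (unitarymxP W1u) mxE eqxx.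
  rewrite -[RHS]E1.
  by rewrite /sform trmxCK mulmx1 !mxE; apply: eq_bigr => k _; rewrite !mxE.
have -> : sform 1%:M (col j W2) (col j W2) = 1.
  have E2 : (W2^t* *m W2) j j = 1.
    by rewrite -invmx_unitary// mulVmx ?unitarymx_unit// mxE eqxx.
  rewrite -[RHS]E2.
  rewrite /sform mulmx1 !mxE; apply: eq_bigr => k _; by rewrite !mxE.
by rewrite -mulr2n lerMn2r.
Qed.

(** Duality of operator norm and trace norm: by cyclicity the trace is a sum of [d 0 j] times
    entries covered by [contractive_unitary_diag]. *)
Lemma contractive_trace n (B F G P : 'M[C]_n) (d : 'rV[C]_n) : contractive B ->
  F \is unitarymx -> G \is unitarymx -> P \is unitarymx ->
  (forall j, 0 <= d 0 j) ->
  `|\tr (B *m (F *m udmx P d *m G))| <= \tr (udmx P d).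
Proof.
move=> Bc Fu Gu Pu d0; rewrite mxtrace_udmx// /udmx.
have -> : \tr (B *m (F *m (P^t* *m diag_mx d *m P) *m G)) =
  \tr ((P *m G) *m B *m (F *m P^t*) *m diag_mx d).
  transitivity (\tr ((B *m F *m P^t* *m diag_mx d) *m (P *m G))).
    by rewrite !mulmxA.
  by rewrite mxtrace_mulC !mulmxA.
rewrite /mxtrace; apply: le_trans (ler_norm_sum _ _ _) _.
apply: ler_sum => j _; rewrite mul_mx_diag mxE normrM [`|d 0 j|]ger0_norm//.
rewrite ler_piMl//; apply: contractive_unitary_diag => //.
  exact: mul_unitarymx.
by apply: mul_unitarymx => //; rewrite trmxC_unitary.
Qed.

End Contractions.

(** * Exponential sums in one complex variable, scalar and matrix valued *)

Section ExponentialSums.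
Variable R : realType.
Local Notation C := R[i].
Local Notation "x %:C" := (real_complex R x) (format "x %:C").

Definition cexp (z : C) : C :=
  Complex (expR (complex.Re z) * cos (complex.Im z))
          (expR (complex.Re z) * sin (complex.Im z)).

Lemma cexpD z w : cexp (z + w) = cexp z * cexp w.
Proof.
case: z w => [a b] [c d]; rewrite /cexp /=; apply/eqP; rewrite eq_complex /=.
by rewrite expRD cosD sinD; apply/andP; split; apply/eqP; ring.
Qed.

Lemma cexp_real x : cexp x%:C = (expR x)%:C.
Proof. by rewrite /cexp /= cos0 sin0 mulr1 mulr0. Qed.

Lemma cexp0 : cexp 0 = 1.
Proof. by rewrite -[0]/(0%:C) cexp_real expR0. Qed.

Lemma norm_cexp_imag (l y : R) : `|cexp (l%:C * Complex 0 y)| = 1.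
Proof.
rewrite normc_def /cexp /= !mul0r subr0 mulr0 addr0 expR0 !mul1r.
by rewrite cos2Dsin2 sqrtr1.
Qed.

Lemma Re_cexp (mu x y : R) (c : C) :
  complex.Re (c * cexp (mu%:C * Complex x y)) =
  expR (mu * x) * (complex.Re c * cos (mu * y) - complex.Im c * sin (mu * y)).
Proof.
by case: c => a b; rewrite /cexp /= !mul0r subr0 addr0; ring.
Qed.

Lemma ReD (z w : C) : complex.Re (z + w) = complex.Re z + complex.Re w.
Proof. by case: z w => [a b] [c d]. Qed.

Lemma Re_sum I (s : seq I) (F : I -> C) :
  complex.Re (\sum_(k <- s) F k) = \sum_(k <- s) complex.Re (F k).
Proof.
by elim: s => [|k s IH]; rewrite ?big_nil// !big_cons ReD IH.
Qed.

(* [D] is the derivative at 0 of the exponential sum [F]. *)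
Definition expsum (F : C -> C) (D : C) := exists s : seq (R * C),
  (forall z, F z = \sum_(p <- s) p.2 * cexp (p.1%:C * z)) /\
  D = \sum_(p <- s) p.1%:C * p.2.

(** The real part of [F] is the harmonic sum of [three_lines_derivative], with frequencies [p.1] and
    with [a], [b] the real and imaginary parts of [p.2]. *)
Lemma expsum_three_lines F D (c d : R) : expsum F D ->
  (forall y, complex.Re (F (Complex 0 y)) <= c) ->
  (forall y, complex.Re (F (Complex 1 y)) <= d) ->
  complex.Re (F 0) = c -> complex.Re D <= d - c.
Proof.
move=> [s [FE ->]] F0 F1 F00.
have ReF x y : complex.Re (F (Complex x y)) = \sum_(p <- s) expR (p.1 * x) *
    (complex.Re p.2 * cos (p.1 * y) - complex.Im p.2 * sin (p.1 * y)).
  by rewrite FE Re_sum; apply: eq_bigr => p _; rewrite Re_cexp.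
rewrite Re_sum; under eq_bigr => p _.
  have -> : complex.Re (p.1%:C * p.2) = complex.Re p.2 * p.1.
    by case: p => mu [a b] /=; ring.
  over.
apply: (@three_lines_derivative _ _ _ fst _ (fun p => complex.Im p.2)) => [y|y|].
- by rewrite -ReF.
- by rewrite -ReF.
- by rewrite -ReF.
Qed.

Lemma expsum_cexp (mu : R) c : expsum (fun z => c * cexp (mu%:C * z)) (c * mu%:C).
Proof.
by exists [:: (mu, c)]; split=> [z|]; rewrite big_seq1//= mulrC.
Qed.

Lemma expsum_cst c : expsum (fun=> c) 0.
Proof.
exists [:: (0, c)]; split=> [z|]; rewrite big_seq1/=; last by rewrite mul0r.
by rewrite mul0r cexp0 mulr1.
Qed.

Lemma expsumD F G D E : expsum F D -> expsum G E ->
  expsum (fun z => F z + G z) (D + E).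
Proof.
move=> [s [FE ->]] [t [GE ->]]; exists (s ++ t).
by split=> [z|]; rewrite big_cat// FE GE.
Qed.

(** Frequencies add and coefficients multiply; the derivative obeys the Leibniz rule. *)
Lemma expsumM F G D E : expsum F D -> expsum G E ->
  expsum (fun z => F z * G z) (D * G 0 + F 0 * E).
Proof.
move=> [s [FE ->]] [t [GE ->]].
exists [seq (p.1 + q.1, p.2 * q.2) | p <- s, q <- t]; split=> [z|].
  rewrite big_allpairs_dep FE GE mulr_suml; apply: eq_bigr => p _.
  rewrite mulr_sumr; apply: eq_bigr => q _.
  by rewrite /= rmorphD mulrDl cexpD; ring.
rewrite big_allpairs_dep FE GE !mulr_suml -big_split; apply: eq_bigr => p _ /=.
rewrite !mulr_sumr -big_split; apply: eq_bigr => q _ /=.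
by rewrite !mulr0 cexp0 rmorphD; ring.
Qed.

Lemma expsum_sum I (r : seq I) (F : I -> C -> C) (D : I -> C) :
  (forall k, expsum (F k) (D k)) ->
  expsum (fun z => \sum_(k <- r) F k z) (\sum_(k <- r) D k).
Proof.
move=> H; elim: r => [|k r IH].
  have := expsum_cst 0; rewrite big_nil.
  by congr expsum; apply/funext => z; rewrite big_nil.
rewrite big_cons; have := expsumD (H k) IH.
by congr expsum; apply/funext => z; rewrite big_cons.
Qed.

Lemma expsumZ c F D : expsum F D -> expsum (fun z => c * F z) (c * D).
Proof. by move=> /(expsumM (expsum_cst c)); rewrite mul0r add0r. Qed.

Definition mxexpsum m n (M : C -> 'M[C]_(m, n)) (D : 'M[C]_(m, n)) :=
  forall i j, expsum (fun z => M z i j) (D i j).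

Lemma mxexpsumM m n p (M : C -> 'M[C]_(m, n)) (N : C -> 'M[C]_(n, p)) D E :
  mxexpsum M D -> mxexpsum N E ->
  mxexpsum (fun z => M z *m N z) (D *m N 0 + M 0 *m E).
Proof.
move=> HM HN i j; rewrite !mxE -big_split/=.
have := expsum_sum (index_enum 'I_n) (fun k => expsumM (HM i k) (HN k j)).
by congr expsum; apply/funext => z; rewrite mxE.
Qed.

Lemma mxexpsum_linear m n (Phi : {linear 'M[C]_n -> 'M[C]_m}) M D :
  mxexpsum M D -> mxexpsum (fun z => Phi (M z)) (Phi D).
Proof.
move=> HM i j.
(* Each entry of [Phi A] is a fixed linear combination of the entries of [A]. *)
have PhiE A : Phi A i j = \sum_a \sum_b Phi (delta_mx a b) i j * A a b.
  rewrite {1}[A]matrix_sum_delta linear_sum summxE; apply: eq_bigr => a _.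
  rewrite linear_sum summxE; apply: eq_bigr => b _.
  by rewrite linearZ mxE mulrC.
rewrite PhiE; have := expsum_sum (index_enum 'I_n) (fun a =>
  expsum_sum (index_enum 'I_n) (fun b => expsumZ (Phi (delta_mx a b) i j) (HM a b))).
by congr expsum; apply/funext => z; rewrite PhiE.
Qed.

Lemma expsum_trace n (M : C -> 'M[C]_n) D :
  mxexpsum M D -> expsum (fun z => \tr (M z)) (\tr D).
Proof. by move=> HM; exact: (expsum_sum _ (fun k => HM k k)). Qed.

(* With A = P^* diag(l) P, [mxpow P l z] is exp(z A). *)
Definition mxpow n (P : 'M[C]_n) (l : 'I_n -> R) (z : C) : 'M[C]_n :=
  udmx P (\row_j cexp ((l j)%:C * z)).

Definition mxherm n (P : 'M[C]_n) (l : 'I_n -> R) : 'M[C]_n :=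
  udmx P (\row_j (l j)%:C).

Variables (n : nat) (P : 'M[C]_n) (l : 'I_n -> R).
Hypothesis Pu : P \is unitarymx.

Lemma mxpowD z w : mxpow P l (z + w) = mxpow P l z *m mxpow P l w.
Proof.
rewrite /mxpow (udmx_rowM _ _ Pu); congr udmx; apply/rowP => j.
by rewrite mxE [RHS]mxE mulrDr cexpD.
Qed.

Lemma mxpow0 : mxpow P l 0 = 1%:M.
Proof.
rewrite -(udmx1 Pu); congr udmx; apply/rowP => j.
by rewrite !mxE mulr0 cexp0.
Qed.

Lemma mxpow_unitary y : mxpow P l (Complex 0 y) \is unitarymx.
Proof. by apply: udmx_unitary => // j; rewrite mxE norm_cexp_imag. Qed.

(** Entrywise the frequencies are [l k * b], and the constant exponent [a] goes into the
    coefficients. *)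
Lemma mxexpsum_mxpow (a b : R) :
  mxexpsum (fun z => mxpow P l (a%:C + b%:C * z))
    (b%:C *: (mxherm P l *m mxpow P l a%:C)).
Proof.
move=> i j; rewrite mxE (udmx_rowM _ _ Pu) udmxE mulr_sumr.
have H k := expsumZ ((P k i)^* * P k j)
  (expsum_cexp (l k * b) (cexp ((l k)%:C * a%:C))).
have := expsum_sum (index_enum 'I_n) H; congr expsum; last first.
  by apply: eq_bigr => k _; rewrite [in RHS]mxE rmorphM; ring.
apply/funext => z; rewrite udmxE; apply: eq_bigr => k _.
rewrite [in RHS]mxE mulrDr cexpD.
have -> : (l k * b)%:C * z = (l k)%:C * (b%:C * z) by rewrite rmorphM mulrA.
by rewrite [RHS]mulrC.
Qed.

End ExponentialSums.

(** * Exponential and logarithm through the spectral decomposition *)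

Lemma lim_sum_scale (K : numFieldType) (V : normedModType K) (I : Type)
    (r : seq I) (c : I -> nat -> K) (a : I -> K) (v : I -> V) :
  (forall j, (c j @ \oo --> (a j : K^o))%classic) ->
  (limn (fun N => \sum_(j <- r) c j N *: v j) = \sum_(j <- r) a j *: v j)%classic.
Proof.
move=> ca; apply: cvg_lim; first exact: norm_hausdorff.
apply: cvg_big => [|j _]; first by move=> x; exact: add_continuous.
by apply: cvgZr_tmp; exact: ca.
Qed.

Section ExpLog.
Variable R : realType.
Local Notation C := R[i].
Local Notation "x %:C" := (real_complex R x) (format "x %:C").
Local Open Scope classical_set_scope.

Lemma real_complex_continuous : continuous (fun x : R => x%:C : C^o).
Proof.
move=> x; apply/cvgrPdist_lt => e e0.
(* A positive element of [R[i]] has zero imaginary part. *)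
have [r [r0 eE]] : exists r, 0 < r /\ e = r%:C.
  case: e e0 => a b; rewrite ltcE/= => /andP[/eqP -> a0].
  by exists a.
exists r => //= y; rewrite /ball_/= => xy.
by rewrite eE -rmorphB normc_def/= expr0n/= addr0 sqrtr_sqr ltcR.
Qed.

Lemma udmx_exp n (P : 'M[C]_n) (l : 'I_n -> R) k : P \is unitarymx ->
  mxherm P l ^+ k = mxherm P (fun j => l j ^+ k).
Proof.
move=> Pu; elim: k => [|k IH].
  rewrite expr0 /mxherm -[LHS](udmx1 Pu); congr udmx; apply/rowP => j.
  by rewrite !mxE.
rewrite exprS IH /mxherm [LHS](udmx_rowM _ _ Pu); congr udmx.
by apply/rowP => j; rewrite [LHS]mxE [RHS]mxE exprS rmorphM.
Qed.

(** All partial sums are diagonal in the same basis, so the limit reduces to the scalar exponential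
    series at each eigenvalue. *)
Lemma expmx_mxherm n (P : 'M[C]_n) (l : 'I_n -> R) : P \is unitarymx ->
  expmx (mxherm P l) = mxherm P (fun j => expR (l j)).
Proof.
move=> Pu; rewrite /expmx.
have serE : series (fun k => k`!%:R^-1 *: mxherm P l ^+ k) =
  (fun N => \sum_j (series (exp_coeff (l j)) N)%:C *: udmx P (delta_mx 0 j)).
  apply/funext => N; rewrite /series /=.
  transitivity (\sum_(0 <= k < N) \sum_j (exp_coeff (l j) k)%:C *: udmx P (delta_mx 0 j)).
    apply: eq_bigr => k _; rewrite udmx_exp// /mxherm udmx_sum scaler_sumr.
    apply: eq_bigr => j _; rewrite scalerA; congr (_ *: _).
    by rewrite mxE /exp_coeff/= mulrC rmorphM fmorphV rmorph_nat.
  rewrite exchange_big; apply: eq_bigr => j _.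
  by rewrite -scaler_suml rmorph_sum.
rewrite serE (@lim_sum_scale _ _ _ (index_enum 'I_n)
  (fun j N => (series (exp_coeff (l j)) N)%:C) (fun j => (expR (l j))%:C)) => [|j].
  by rewrite /mxherm [RHS]udmx_sum; apply: eq_bigr => j _; rewrite mxE.
apply: (continuous_cvg _ (@real_complex_continuous (expR (l j)))).
exact: is_cvg_series_exp_coeff.
Qed.

Lemma hermsymmx_mxherm n (A : 'M[C]_n) : A \is hermsymmx ->
  A = mxherm (spectralmx A) (fun j => complex.Re (spectral_diag A 0 j)).
Proof.
move=> Ah; rewrite [LHS](normalmx_udmx (hermitian_normalmx Ah)).
congr udmx; apply/rowP => j; rewrite mxE RRe_real//.
by have /mxOverP := hermitian_spectral_diag_real Ah; apply.
Qed.

Lemma mxherm_hermsymmx n (P : 'M[C]_n) (l : 'I_n -> R) : mxherm P l \is hermsymmx.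
Proof.
apply/hermsymmxP; rewrite /mxherm udmx_trC; congr udmx; apply/rowP => j.
by rewrite !mxE; apply: conj_Creal; apply/complex_realP; exists (l j).
Qed.

Lemma logmxE n (A : 'M[C]_n) :
  logmx A = mxherm (spectralmx A) (fun j => ln (complex.Re (spectral_diag A 0 j))).
Proof.
rewrite /logmx (invmx_unitary (spectral_unitarymx A)).
suff -> : map_mx (fun z => (ln (complex.Re z))%:C) (spectral_diag A) =
  \row_j (ln (complex.Re (spectral_diag A 0 j)))%:C by [].
by apply/rowP => j; rewrite mxE mxE.
Qed.

Lemma logmx_hermsymmx n (A : 'M[C]_n) : logmx A \is hermsymmx.
Proof. by rewrite logmxE; exact: mxherm_hermsymmx. Qed.

(** [expR] inverts [ln] on positive reals only; testing [A] on the rows of [spectralmx A] shows that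
    the eigenvalues are positive. *)
Lemma expmx_logmx n (A : 'M[C]_n) : pdmx A -> expmx (logmx A) = A.
Proof.
move=> [Ah Apos]; rewrite logmxE expmx_mxherm ?spectral_unitarymx//.
rewrite [RHS](hermsymmx_mxherm Ah); congr mxherm; apply/funext => j.
have Pu := spectral_unitarymx A; rewrite lnK// posrE.
have := Apos ((row j (spectralmx A))^t*).
rewrite trmxCK.
have -> : (row j (spectralmx A) *m A *m (row j (spectralmx A))^t*) 0 0 =
    (complex.Re (spectral_diag A 0 j))%:C.
  by rewrite {2}(hermsymmx_mxherm Ah) (udmx_row _ _ Pu) mxE.
(* The row is nonzero because it has norm 1, which is [udmx_row] for the identity matrix. *)
rewrite ltcR; apply; apply/eqP => rj0.
have := udmx_row (const_mx 1) j Pu; rewrite (udmx1 Pu) mulmx1 rj0 mulmx0 !mxE.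
by move=> /eqP; rewrite eq_sym oner_eq0.
Qed.

End ExpLog.

(** * Positive semidefinite matrices: congruence, trace pairing, hermiticity *)

Section PositiveMaps.
Variable C : numClosedFieldType.
Implicit Types n m : nat.

Lemma psform_congr n (A Q : 'M[C]_n) : Q \is hermsymmx -> psform A ->
  psform (Q *m A *m Q).
Proof.
move=> /hermsymmxP Qh [/hermsymmxP Ah Apos]; split.
  by apply/hermsymmxP; rewrite !trmx_mul !map_mxM Qh Ah mulmxA.
move=> v; have := Apos (Q *m v).
by rewrite /sform trmx_mul map_mxM Qh !mulmxA.
Qed.

Lemma psform_rank1 n (v : 'cV[C]_n) : psform (v *m v^t*).
Proof.
split; first by apply/hermsymmxP; rewrite trmx_mul map_mxM trmxCK.
move=> u; have -> : sform (v *m v^t*) u u = (u^t* *m v) 0 0 * ((u^t* *m v) 0 0)^*.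
  have -> : ((u^t* *m v) 0 0)^* = (v^t* *m u) 0 0.
    by rewrite -trmxCE trmx_mul map_mxM trmxCK.
  by rewrite /sform !mulmxA -mulmxA mxE big_ord1.
exact: mul_conjC_ge0.
Qed.

(** In the eigenbasis of the first factor, the trace is a sum of eigenvalues times values of the
    form of [A]. *)
Lemma psform_trace_mul n (A : 'M[C]_n) (P : 'M[C]_n) (d : 'rV[C]_n) :
  psform A -> (forall j, 0 <= d 0 j) -> 0 <= \tr (udmx P d *m A).
Proof.
move=> [_ Apos] d0.
have -> : \tr (udmx P d *m A) = \sum_j (P *m A *m P^t*) j j * d 0 j.
  transitivity (\tr ((P^t* *m diag_mx d) *m (P *m A))).
    by rewrite /udmx !mulmxA.
  rewrite mxtrace_mulC mulmxA; apply: eq_bigr => j _.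
  by rewrite mul_mx_diag mxE.
apply: sumr_ge0 => j _; rewrite mulr_ge0// mulmx_diagE.
have -> : col j (P^t*) = (row j P)^t* by apply/colP => k; rewrite !mxE.
exact: Apos.
Qed.

(* Polarization along [e a + c *: e b] with [c = 1] and [c = 'i]. *)
Lemma sform_ge0_hermsymmx n (A : 'M[C]_n) :
  (forall v, 0 <= sform A v v) -> A \is hermsymmx.
Proof.
move=> Apos; apply/hermsymmxP/matrixP => a b; rewrite trmxCE.
pose e (k : 'I_n) : 'cV[C]_n := delta_mx k 0.
have eE k l : sform A (e k) (e l) = A k l.
  rewrite /sform /e; have -> : (delta_mx k 0 : 'cV[C]_n)^t* = delta_mx 0 k.
    by apply/matrixP => i j; rewrite !mxE conjC_nat andbC.
  by rewrite -rowE -colE mxE mxE.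
have real v : (sform A v v)^* = sform A v v by rewrite geC0_conj.
have sE c : sform A (e a + c *: e b) (e a + c *: e b) =
    A a a + c * A a b + c^* * A b a + c^* * c * A b b.
  rewrite -!eE /sform.
  have -> : (e a + c *: e b)^t* = (e a)^t* + c^* *: (e b)^t*.
    by apply/matrixP => i j; rewrite !mxE rmorphD rmorphM.
  rewrite !mulmxDl !mulmxDr -!scalemxAl -!scalemxAr !mxE; ring.
have Areal k : (A k k)^* = A k k by rewrite -eE real.
have h c : A a a + c^* * (A a b)^* + c * (A b a)^* + c^* * c * A b b =
    A a a + c * A a b + c^* * A b a + c^* * c * A b b.
  by rewrite -sE -real sE !rmorphD/= !rmorphM/= conjCK !Areal; ring.
have h1 := h 1; have h2 := h 'i; rewrite rmorph1 in h1; rewrite conjCi in h2.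
have i0 : 'i != 0 :> C by exact: neq0Ci.
have g1 : (A a b)^* + (A b a)^* = A a b + A b a.
  apply: (addrI (A a a)); apply: (addIr (A b b)).
  by move: h1; rewrite !mul1r !addrA.
have g2 : (A b a)^* - (A a b)^* = A a b - A b a.
  apply: (mulfI i0); apply: (addrI (A a a)); apply: (addIr ('i * - 'i * A b b)).
  have e1 : 'i * - 'i = - 'i * 'i :> C by ring.
  transitivity (A a a + - 'i * (A a b)^* + 'i * (A b a)^* + 'i * - 'i * A b b).
    by ring.
  by rewrite e1 h2; ring.
have : 2 * (A b a)^* = 2 * A a b.
  have -> : 2 * (A b a)^* = ((A a b)^* + (A b a)^*) + ((A b a)^* - (A a b)^*) by ring.
  by rewrite g1 g2; ring.
by move=> /mulfI -> //; rewrite pnatr_eq0.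
Qed.

Lemma contractive_trC n (A : 'M[C]_n) : contractive A -> contractive (A^t*).
Proof.
move=> Ac u v; rewrite addrC; apply: le_trans (Ac v u).
have -> : sform (A^t*) u v = (sform A v u)^*.
  by rewrite /sform -trmxCE !trmx_mul !map_mxM trmxCK mulmxA.
by rewrite norm_conjC.
Qed.

End PositiveMaps.

(** * The adjoint map and the trace bounds on the two edges of the strip *)

Section AdjointMaps.
Variables (C : numClosedFieldType) (n m : nat).
Variables (Phi : {linear 'M[C]_n -> 'M[C]_m}) (Phid : {linear 'M[C]_m -> 'M[C]_n}).
Hypothesis Phi1 : Phi 1%:M = 1%:M.
Hypothesis Phi_pos : forall A, psform A -> psform (Phi A).
Hypothesis Phid_adj : forall A B, \tr ((Phid B)^t* *m A) = \tr (B^t* *m Phi A).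

Lemma psform_udmx k (A : 'M[C]_k) : psform A -> exists P d,
  [/\ P \is unitarymx, A = udmx P d & forall j, 0 <= d 0 j].
Proof.
move=> [Ah Apos]; have := normalmx_udmx (hermitian_normalmx Ah).
have := spectral_unitarymx A; move: (spectralmx A) (spectral_diag A) => P d Pu AE.
exists P, d; split=> // j; rewrite -(udmx_row d j Pu) -AE.
by have := Apos ((row j P)^t*); rewrite /sform trmxCK.
Qed.

(** The form of the adjoint image at [v] is the trace pairing of [B] with the image under [Phi] of
    the rank-one matrix of [v], both positive. *)
Lemma adjoint_positive B : psform B -> psform (Phid B).
Proof.
move=> Bpos; have [Bh _] := Bpos; have [P [d [Pu BE d0]]] := psform_udmx Bpos.
(* The adjoint relation speaks of the conjugate transpose of [Phid B]; nonnegativity of its form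
   makes it Hermitian, which identifies the two. *)
have pos v : 0 <= sform ((Phid B)^t*) v v.
  have -> : sform ((Phid B)^t*) v v = \tr (udmx P d *m Phi (v *m v^t*)).
    rewrite -BE -[in RHS](hermsymmxP _ Bh) -Phid_adj mulmxA mxtrace_mulC.
    by rewrite mulmxA /sform trace_mx11.
  by apply: psform_trace_mul => //; apply: Phi_pos; exact: psform_rank1.
have h := hermsymmxP _ (sform_ge0_hermsymmx pos); rewrite trmxCK in h.
split; first by apply/hermsymmxP.
by move=> v; rewrite h.
Qed.

(** The edge [Re z = 0]: cyclicity isolates the contraction [Phi W] against a positive matrix placed
    between unitaries. *)
Lemma trace_bound0 (W : 'M[C]_n) (U V V' P : 'M[C]_m) (d : 'rV[C]_m) :
  W \is unitarymx -> U \is unitarymx -> V \is unitarymx -> V' \is unitarymx ->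
  P \is unitarymx -> (forall j, 0 <= d 0 j) ->
  `|\tr (U *m Phi W *m V *m (udmx P d *m V'))| <= \tr (udmx P d).
Proof.
move=> Wu Uu Vu V'u Pu d0.
have -> : \tr (U *m Phi W *m V *m (udmx P d *m V')) =
    \tr (Phi W *m (V *m udmx P d *m (V' *m U))).
  transitivity (\tr (U *m (Phi W *m V *m (udmx P d *m V')))).
    by rewrite !mulmxA.
  by rewrite mxtrace_mulC !mulmxA.
apply: contractive_trace => //; last exact: mul_unitarymx.
apply: unitary_contraction => //; rewrite Phi1 subrr.
split; first by apply/hermsymmxP; rewrite trmx0 map_mx0.
by move=> v; rewrite /sform mulmx0 mul0mx mxE.
Qed.

(** The edge [Re z = 1], with [Ah] as X^(-1/2) and [Bh] as Y^(1/2): duality replaces [Phi] by the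
    subunital positive map [Psi], applied to a single unitary. *)
Lemma trace_bound1 (Ah U2 U3 P : 'M[C]_n) (d : 'rV[C]_n) (Bh U1 U4 U5 : 'M[C]_m) :
  Ah \is hermsymmx -> Bh \is hermsymmx ->
  psform (1%:M - Ah *m Phid (Bh *m Bh) *m Ah) ->
  U1 \is unitarymx -> U2 \is unitarymx -> U3 \is unitarymx ->
  U4 \is unitarymx -> U5 \is unitarymx ->
  P \is unitarymx -> (forall j, 0 <= d 0 j) ->
  `|\tr (U1 *m Bh *m Phi (Ah *m U2 *m udmx P d *m (U3 *m Ah)) *m (Bh *m U4) *m U5)|
    <= \tr (udmx P d).
Proof.
move=> Ahh Bhh dom U1u U2u U3u U4u U5u Pu d0.
(* Cyclicity gathers the outer unitaries; the adjoint is taken because the pairing conjugates its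
   left argument. *)
pose W := (U4 *m U5 *m U1)^t*.
have Wu : W \is unitarymx by rewrite trmxC_unitary !mul_unitarymx.
pose Psi : {linear 'M[C]_m -> 'M[C]_n} :=
  (mulmxr Ah \o (mulmx Ah \o (Phid \o (mulmxr Bh \o mulmx Bh)))).
have PsiE X : Psi X = Ah *m Phid (Bh *m X *m Bh) *m Ah by [].
have Psi_contr : contractive ((Psi W)^t*).
  apply/contractive_trC/unitary_contraction => //.
    move=> X Xpos; rewrite PsiE; apply: psform_congr => //.
    by apply: adjoint_positive; exact: psform_congr.
  by rewrite PsiE mulmx1.
have Ahe := hermsymmxP _ Ahh; have Bhe := hermsymmxP _ Bhh.
set M := Ah *m U2 *m udmx P d *m (U3 *m Ah).
have -> : \tr (U1 *m Bh *m Phi M *m (Bh *m U4) *m U5) =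
    \tr ((Psi W)^t* *m (U2 *m udmx P d *m U3)).
  transitivity (\tr ((Bh *m W *m Bh)^t* *m Phi M)).
    rewrite !trmx_mul !map_mxM Bhe trmxCK [RHS]mxtrace_mulC.
    transitivity (\tr (U1 *m (Bh *m Phi M *m (Bh *m U4) *m U5))).
      by rewrite !mulmxA.
    rewrite [LHS]mxtrace_mulC.
    transitivity (\tr (Bh *m (Phi M *m (Bh *m U4) *m U5 *m U1))).
      by rewrite !mulmxA.
    by rewrite [LHS]mxtrace_mulC !mulmxA.
  rewrite -Phid_adj PsiE [in RHS]trmx_mul [in RHS]trmx_mul !map_mxM Ahe.
  transitivity (\tr ((Phid (Bh *m W *m Bh))^t* *m Ah *m (U2 *m udmx P d *m U3) *m Ah)).
    by rewrite /M !mulmxA.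
  by rewrite [LHS]mxtrace_mulC !mulmxA.
exact: contractive_trace.
Qed.

(** The Leibniz terms at [z = 0], with [L] in the place of e^L. As [h] is 1/2, the factors around
    and inside [Phi] add up to exactly what the last factor removes. *)
Lemma interpolant_derivative_eq0 (h : C) (A K : 'M[C]_n) (B L : 'M[C]_m) :
  h + h = 1 ->
  (h *: B + Phi (- h *: A + K + - h *: A) + h *: B) *m L
    - (Phi (K - A) + B) *m L = 0.
Proof.
move=> hh; rewrite -mulmxBl.
have -> : - h *: A + K + - h *: A = K - A.
  by rewrite addrAC -scalerDl -opprD hh scaleN1r addrC.
have -> : h *: B + Phi (K - A) + h *: B = Phi (K - A) + B.
  by rewrite addrAC -scalerDl hh scale1r addrC.
by rewrite subrr mul0mx.
Qed.

End AdjointMaps.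

(** * The interpolating function on the strip *)

Section Interpolation.
Variable R : realType.
Local Notation C := R[i].
Local Notation "x %:C" := (real_complex R x) (format "x %:C").

Lemma Re_le_norm (z w : C) : `|z| <= w -> complex.Re z <= complex.Re w.
Proof.
move=> /(le_trans (normc_ge_Re z)); rewrite lecE => /andP[_ /=].
exact: le_trans (ler_norm _).
Qed.

Lemma mxpow_real n (P : 'M[C]_n) (l : 'I_n -> R) t :
  mxpow P l t%:C = mxherm P (fun j => expR (l j * t)).
Proof.
by congr udmx; apply/rowP => j; rewrite mxE [RHS]mxE -rmorphM cexp_real.
Qed.

Lemma mxpow1 n (P : 'M[C]_n) (l : 'I_n -> R) :
  mxpow P l 1%:C = mxherm P (fun j => expR (l j)).
Proof.
rewrite mxpow_real; congr udmx; apply/rowP => j.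
by rewrite mxE [RHS]mxE mulr1.
Qed.

Lemma mxtrace_mxherm n (P : 'M[C]_n) (l : 'I_n -> R) : P \is unitarymx ->
  \tr (mxherm P l) = (\sum_j l j)%:C.
Proof.
move=> Pu; rewrite mxtrace_udmx// rmorph_sum; apply: eq_bigr => j _.
by rewrite mxE.
Qed.

Lemma affine_complex (a b x y : R) :
  a%:C + b%:C * Complex x y = (a + b * x)%:C + Complex 0 (b * y).
Proof. by apply/eqP; rewrite eq_complex /=; apply/andP; split; apply/eqP; ring. Qed.

Variables (n m : nat).
Variables (Phi : {linear 'M[C]_n -> 'M[C]_m}) (Phid : {linear 'M[C]_m -> 'M[C]_n}).
Hypothesis Phi1 : Phi 1%:M = 1%:M.
Hypothesis Phi_pos : forall A, psform A -> psform (Phi A).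
Hypothesis Phid_adj : forall A B, \tr ((Phid B)^t* *m A) = \tr (B^t* *m Phi A).
Variables (PA PK : 'M[C]_n) (lA lK : 'I_n -> R).
Variables (PB PL : 'M[C]_m) (lB lL : 'I_m -> R).
Hypotheses (PAu : PA \is unitarymx) (PKu : PK \is unitarymx).
Hypotheses (PBu : PB \is unitarymx) (PLu : PL \is unitarymx).
Hypothesis PhiE : mxherm PL lL = Phi (mxherm PK lK - mxherm PA lA) + mxherm PB lB.
Hypothesis dom : psform (mxpow PA lA 1 - Phid (mxpow PB lB 1)).

(* [h] is 1/2, kept abstract so that unification does not unfold [2^-1]. *)
Variable h : R.
Hypothesis hh : h + h = 1.

(** The constants 0 and 1 are written out so that all four exponents have the affine form of
    [mxexpsum_mxpow] and [mxpow_affine]. *)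
Let pB z := mxpow PB lB (0%:C + h%:C * z).
Let pA z := mxpow PA lA (0%:C + (- h)%:C * z).
Let pK z := mxpow PK lK (0%:C + 1%:C * z).
Let pL z := mxpow PL lL (1%:C + (-1)%:C * z).
Let F z := \tr (pB z *m Phi (pA z *m pK z *m pA z) *m pB z *m pL z).

Lemma interpolant_derivative : expsum F 0.
Proof.
have eB : mxexpsum pB _ := mxexpsum_mxpow lB PBu 0 h.
have eA : mxexpsum pA _ := mxexpsum_mxpow lA PAu 0 (- h).
have eK : mxexpsum pK _ := mxexpsum_mxpow lK PKu 0 1.
have eL : mxexpsum pL _ := mxexpsum_mxpow lL PLu 1 (- 1).
have := expsum_trace (mxexpsumM (mxexpsumM (mxexpsumM eB
  (mxexpsum_linear Phi (mxexpsumM (mxexpsumM eA eK) eA))) eB) eL).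
rewrite -[X in X -> _]/(expsum F _).
(* At 0 every factor but [pL] is the identity, and [Phi] is unital. *)
congr expsum; rewrite /pA /pB /pK /pL !mulr0 !addr0.
rewrite (rmorph0 (real_complex R)) !mxpow0// !(mulmx1, mul1mx) Phi1.
rewrite !(mulmx1, mul1mx).
have hhC : h%:C + h%:C = 1 by rewrite -rmorphD hh.
have := interpolant_derivative_eq0 Phi (mxherm PA lA) (mxherm PK lK) (mxherm PB lB)
  (mxpow PL lL 1%:C) hhC.
rewrite -PhiE => e0.
have hN : (- h)%:C = - h%:C by rewrite rmorphN.
have h1 : (-1)%:C = -1 by rewrite rmorphN rmorph1.
by rewrite hN h1 (rmorph1 (real_complex R)) scale1r scaleN1r e0 mxtrace0.
Qed.

Lemma interpolant0 : F 0 = (\sum_j expR (lL j))%:C.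
Proof.
rewrite /F /pA /pB /pK /pL !mulr0 !addr0 (rmorph0 (real_complex R)) !mxpow0//.
rewrite !(mulmx1, mul1mx) Phi1 !(mulmx1, mul1mx) mxpow1.
exact: mxtrace_mxherm.
Qed.

Lemma mxpow_affine k (P : 'M[C]_k) l a b x y : P \is unitarymx ->
  mxpow P l (a%:C + b%:C * Complex x y) =
    mxpow P l (a + b * x)%:C *m mxpow P l (Complex 0 (b * y)).
Proof. by move=> Pu; rewrite affine_complex mxpowD. Qed.

Lemma mxpow_affineC k (P : 'M[C]_k) l a b x y : P \is unitarymx ->
  mxpow P l (a%:C + b%:C * Complex x y) =
    mxpow P l (Complex 0 (b * y)) *m mxpow P l (a + b * x)%:C.
Proof. by move=> Pu; rewrite affine_complex addrC mxpowD. Qed.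

Lemma expR_row_ge0 k (l : 'I_k -> R) j : 0 <= (\row_i (expR (l i))%:C) 0 j :> C.
Proof. by rewrite mxE ler0c expR_ge0. Qed.

(** Here [pA], [pB], [pK] are unitary and [pL] is e^L times a unitary, so [trace_bound0] applies. *)
Lemma interpolant_left y : complex.Re (F (Complex 0 y)) <= \sum_j expR (lL j).
Proof.
rewrite -[leRHS]/(complex.Re (\sum_j expR (lL j))%:C) -(mxtrace_mxherm _ PLu).
apply: Re_le_norm; rewrite /F /pA /pB /pK /pL.
rewrite !(mxpow_affine lB _ _ _ _ PBu) !(mxpow_affine lA _ _ _ _ PAu).
rewrite (mxpow_affine lK _ _ _ _ PKu) (mxpow_affine lL _ _ _ _ PLu)
  (mulr0 h) (mulr0 (- h)) (mulr0 1) (mulr0 (-1)).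
rewrite !addr0 (rmorph0 (real_complex R)).
rewrite (mxpow0 lA PAu) (mxpow0 lB PBu) (mxpow0 lK PKu) !mul1mx mxpow1.
have UA := mxpow_unitary lA PAu (- h * y).
have UB := mxpow_unitary lB PBu (h * y).
have UK := mxpow_unitary lK PKu (1 * y).
have UL := mxpow_unitary lL PLu (-1 * y).
have b := trace_bound0 Phi1 Phi_pos (mul_unitarymx (mul_unitarymx UA UK) UA)
  UB UB UL PLu (expR_row_ge0 lL).
exact: b.
Qed.

(** Here [pL] is unitary, [pK] is e^K times a unitary, and [pA], [pB] contribute X^(-1/2) and
    Y^(1/2), so [trace_bound1] applies. *)
Lemma interpolant_right y : complex.Re (F (Complex 1 y)) <= \sum_j expR (lK j).
Proof.
rewrite -[leRHS]/(complex.Re (\sum_j expR (lK j))%:C) -(mxtrace_mxherm _ PKu).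
apply: Re_le_norm; rewrite /F.
have -> : pL (Complex 1 y) = mxpow PL lL (Complex 0 (-1 * y)).
  rewrite /pL (mxpow_affine lL _ _ _ _ PLu) (mulr1 (-1)) subrr (rmorph0 (real_complex R)).
  by rewrite (mxpow0 lL PLu) mul1mx.
have -> : pK (Complex 1 y) =
    mxherm PK (fun j => expR (lK j)) *m mxpow PK lK (Complex 0 (1 * y)).
  by rewrite /pK (mxpow_affine lK _ _ _ _ PKu) (mulr1 1) (add0r 1) mxpow1.
(* The order of the commuting factors is chosen at each occurrence so that the Hermitian ones are
   next to [Phi], inside or outside. *)
have pBE : pB (Complex 1 y) =
    mxpow PB lB h%:C *m mxpow PB lB (Complex 0 (h * y)).
  rewrite /pB (mxpow_affine lB _ _ _ _ PBu) (mulr1 h) (add0r h); exact: erefl.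
have pBE' : pB (Complex 1 y) =
    mxpow PB lB (Complex 0 (h * y)) *m mxpow PB lB h%:C.
  rewrite /pB (mxpow_affineC lB _ _ _ _ PBu) (mulr1 h) (add0r h); exact: erefl.
have pAE : pA (Complex 1 y) =
    mxpow PA lA (- h)%:C *m mxpow PA lA (Complex 0 (- h * y)).
  rewrite /pA (mxpow_affine lA _ _ _ _ PAu) (mulr1 (- h)) (add0r (- h)); exact: erefl.
have pAE' : pA (Complex 1 y) =
    mxpow PA lA (Complex 0 (- h * y)) *m mxpow PA lA (- h)%:C.
  rewrite /pA (mxpow_affineC lA _ _ _ _ PAu) (mulr1 (- h)) (add0r (- h)); exact: erefl.
rewrite {1}pBE' pBE {1}pAE pAE'.
have UA := mxpow_unitary lA PAu (- h * y).
have UB := mxpow_unitary lB PBu (h * y).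
have UK := mxpow_unitary lK PKu (1 * y).
have UL := mxpow_unitary lL PLu (-1 * y).
have Ahh : mxpow PA lA (- h)%:C \is hermsymmx.
  by rewrite mxpow_real; exact: mxherm_hermsymmx.
have Bhh : mxpow PB lB h%:C \is hermsymmx.
  by rewrite mxpow_real; exact: mxherm_hermsymmx.
have Bdouble : mxpow PB lB h%:C *m mxpow PB lB h%:C = mxpow PB lB 1.
  by rewrite -(mxpowD lB PBu) -rmorphD hh.
(* X^(-1/2) X X^(-1/2) = 1, so congruence by X^(-1/2) turns [dom] into subunitality. *)
have Acancel : mxpow PA lA (- h)%:C *m mxpow PA lA 1 *m mxpow PA lA (- h)%:C = 1%:M.
  have h0 : (- h)%:C + 1 + (- h)%:C = 0.
    by rewrite -[1]/(1%:C) -!rmorphD -hh addrA addNr add0r addrN.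
  by rewrite -!(mxpowD lA PAu) h0 (mxpow0 lA PAu).
have domA : psform (1%:M - mxpow PA lA (- h)%:C *m
    Phid (mxpow PB lB h%:C *m mxpow PB lB h%:C) *m mxpow PA lA (- h)%:C).
  rewrite Bdouble -{1}Acancel -mulmxBl -mulmxBr; exact: psform_congr.
move: Ahh Bhh domA UA UB UK UL.
move: (mxpow PA lA (- h)%:C) (mxpow PB lB h%:C) (mxpow PA lA (Complex 0 _))
  (mxpow PB lB (Complex 0 _)) (mxpow PK lK _) (mxpow PL lL _).
move=> Ah Bh UA UB UK UL Ahh Bhh domA UAu UBu UKu ULu.
have -> : Ah *m UA *m (mxherm PK (fun j => expR (lK j)) *m UK) *m (UA *m Ah) =
    Ah *m UA *m mxherm PK (fun j => expR (lK j)) *m ((UK *m UA) *m Ah).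
  by rewrite !mulmxA.
exact: (trace_bound1 Phi_pos Phid_adj Ahh Bhh domA UBu UAu
  (mul_unitarymx UKu UAu) UBu ULu PKu (expR_row_ge0 lK)).
Qed.

End Interpolation.

(** The interpolant has derivative 0 at 0, so the three lines bound says that the difference of the
    two sums is nonnegative. *)
Lemma sum_expR_le (R : realType) n m (Phi : {linear 'M[R[i]]_n -> 'M[R[i]]_m})
    (Phid : {linear 'M[R[i]]_m -> 'M[R[i]]_n})
    (PA PK : 'M[R[i]]_n) (lA lK : 'I_n -> R)
    (PB PL : 'M[R[i]]_m) (lB lL : 'I_m -> R) :
  Phi 1%:M = 1%:M -> (forall A, psform A -> psform (Phi A)) ->
  (forall A B, \tr ((Phid B)^t* *m A) = \tr (B^t* *m Phi A)) ->
  PA \is unitarymx -> PK \is unitarymx -> PB \is unitarymx -> PL \is unitarymx ->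
  mxherm PL lL = Phi (mxherm PK lK - mxherm PA lA) + mxherm PB lB ->
  psform (mxpow PA lA 1 - Phid (mxpow PB lB 1)) ->
  \sum_j expR (lL j) <= \sum_j expR (lK j).
Proof.
move=> Phi1 Phi_pos adj PAu PKu PBu PLu PhiE dom.
have hh : 2^-1 + 2^-1 = 1 :> R by lra.
have D := interpolant_derivative Phi1 PAu PKu PBu PLu PhiE hh.
rewrite -subr_ge0; apply: (expsum_three_lines D) => [y|y|].
- exact: interpolant_left.
- exact: (interpolant_right Phi_pos adj).
- by rewrite interpolant0.
Qed.

(** * From eigenvalue sums to the trace inequality and its regularised limit *)

Section TraceInequality.

Lemma hermsymmxD (C : numClosedFieldType) n (A B : 'M[C]_n) :
  A \is hermsymmx -> B \is hermsymmx -> A + B \is hermsymmx.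
Proof.
move=> /hermsymmxP Ah /hermsymmxP Bh; apply/hermsymmxP/matrixP => i j.
by rewrite trmxCE [(A + B) j i]mxE [(A + B) i j]mxE rmorphD/= -!trmxCE Ah Bh.
Qed.

(** A Hermitian matrix is a real combination of positive matrices, whose images are Hermitian. *)
Lemma positive_map_hermsymmx (C : numClosedFieldType) n m
    (Phi : {linear 'M[C]_n -> 'M[C]_m}) A :
  (forall A, psform A -> psform (Phi A)) -> A \is hermsymmx -> Phi A \is hermsymmx.
Proof.
move=> Phi_pos Ah; have := normalmx_udmx (hermitian_normalmx Ah).
have := hermitian_spectral_diag_real Ah.
move: (spectralmx A) (spectral_diag A) => P d /mxOverP dreal ->.
rewrite udmx_sum linear_sum; apply/hermsymmxP/matrixP => i j.
rewrite trmxCE !summxE rmorph_sum; apply: eq_bigr => k _.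
have PhiZ a b : Phi (d 0 k *: udmx P (delta_mx 0 k)) a b =
    d 0 k * Phi (udmx P (delta_mx 0 k)) a b by rewrite linearZ mxE.
rewrite !PhiZ rmorphM/= -(trmxCE (Phi _)).
have [Qh _] : psform (Phi (udmx P (delta_mx 0 k))).
  apply: Phi_pos; apply: udmx_psform => l.
  by rewrite mxE ler0n.
by rewrite (hermsymmxP _ Qh) conj_Creal.
Qed.

Lemma psform_scalar (C : numClosedFieldType) n (c : C) :
  0 <= c -> psform (c%:M : 'M[C]_n).
Proof.
move=> c0; have -> : c%:M = udmx 1%:M (const_mx c) :> 'M[C]_n.
  by rewrite /udmx mulmx1 diag_const_mx trmx1 map_mx1 mul1mx.
by apply: udmx_psform => j; rewrite mxE.
Qed.

Variable R : realType.
Local Notation C := R[i].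
Local Notation "x %:C" := (real_complex R x) (format "x %:C").

Lemma expmxE n (A : 'M[C]_n) : A \is hermsymmx ->
  expmx A = mxpow (spectralmx A) (fun j => complex.Re (spectral_diag A 0 j)) 1.
Proof.
move=> Ah; rewrite {1}(hermsymmx_mxherm Ah) (expmx_mxherm _ (spectral_unitarymx A)).
by rewrite -[1]/(1%:C) mxpow1.
Qed.

Lemma mxtrace_expmx n (A : 'M[C]_n) : A \is hermsymmx ->
  \tr (expmx A) = (\sum_j expR (complex.Re (spectral_diag A 0 j)))%:C.
Proof.
move=> Ah; rewrite {1}(hermsymmx_mxherm Ah) (expmx_mxherm _ (spectral_unitarymx A)).
by rewrite (mxtrace_mxherm _ (spectral_unitarymx A)).
Qed.

(** [A] and [B] play log X and log Y; diagonalising [A], [B], [H + A] and [Phi H + B] reduces the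
    claim to [sum_expR_le]. *)
Lemma trace_exp_le n m (Phi : {linear 'M[C]_n -> 'M[C]_m})
    (Phid : {linear 'M[C]_m -> 'M[C]_n}) (H A : 'M[C]_n) (B : 'M[C]_m) :
  Phi 1%:M = 1%:M -> (forall A, psform A -> psform (Phi A)) ->
  (forall A B, \tr ((Phid B)^t* *m A) = \tr (B^t* *m Phi A)) ->
  H \is hermsymmx -> A \is hermsymmx -> B \is hermsymmx ->
  psform (expmx A - Phid (expmx B)) ->
  \tr (expmx (Phi H + B)) <= \tr (expmx (H + A)).
Proof.
move=> Phi1 Phi_pos adj Hh Ah Bh dom.
have Kh := hermsymmxD Hh Ah.
have Lh := hermsymmxD (positive_map_hermsymmx Phi_pos Hh) Bh.
rewrite (mxtrace_expmx Kh) (mxtrace_expmx Lh) lecR.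
rewrite (expmxE Ah) (expmxE Bh) in dom.
apply: (sum_expR_le Phi1 Phi_pos adj (spectral_unitarymx A)
  (spectral_unitarymx (H + A)) (spectral_unitarymx B)
  (spectral_unitarymx (Phi H + B)) _ dom).
by rewrite -(hermsymmx_mxherm Kh) -(hermsymmx_mxherm Lh) -(hermsymmx_mxherm Ah)
  -(hermsymmx_mxherm Bh) addrK.
Qed.

Lemma pdmx_psform_add n (X : 'M[C]_n) (e : R) : psform X -> 0 < e ->
  pdmx (X + e%:C%:M).
Proof.
move=> [Xh Xpos] e0; have ec : 0 < e%:C by rewrite ltcR.
have [Eh _] := psform_scalar n (ltW ec).
split; first exact: hermsymmxD.
move=> v v0; rewrite -/(sform _ _ _) sformDl; apply: ltr_wpDl; first exact: Xpos.
rewrite /sform mul_mx_scalar -scalemxAl mxE; apply: mulr_gt0 => //.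
rewrite mxE; have [j vj] : exists j, v j 0 != 0.
  apply/existsP; apply: contraNT v0; rewrite negb_exists => /forallP z.
  by apply/eqP/colP => j; rewrite mxE; apply/eqP; rewrite -[_ == _]negbK z.
rewrite (bigD1 j)//=; apply: ltr_pwDl.
  by rewrite trmxCE mulrC mul_conjC_gt0.
by apply: sumr_ge0 => k _; rewrite trmxCE mulrC mul_conjC_ge0.
Qed.

(** The case of identity maps, where the domination hypothesis is [X <= X']. *)
Lemma trace_exp_add_log_le n (H X X' : 'M[C]_n) : H \is hermsymmx ->
  pdmx X -> pdmx X' -> psform (X' - X) ->
  \tr (expmx (H + logmx X)) <= \tr (expmx (H + logmx X')).
Proof.
move=> Hh Xpd X'pd XX'.
have XX'2 : psform (expmx (logmx X') - expmx (logmx X)).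
  by rewrite (expmx_logmx Xpd) (expmx_logmx X'pd).
exact: (@trace_exp_le n n idfun idfun H (logmx X') (logmx X) erefl
  (fun A h => h) (fun A B => erefl) Hh (logmx_hermsymmx X') (logmx_hermsymmx X) XX'2).
Qed.

(** The regularised trace is real, nondecreasing in [e] and bounded below by [b], so it converges to
    an infimum that is at least [b]. *)
Lemma trace_exp_add_log_cvg n (H X : 'M[C]_n) (b : R) :
  H \is hermsymmx -> psform X ->
  (forall e : R, 0 < e -> b%:C <= \tr (expmx (H + logmx (X + e%:C%:M)))) ->
  exists2 t : C, Tr_exp_add_log H X t & b%:C <= t.
Proof.
move=> Hh Xpos lb.
have [g gE] : exists g : R -> R,
    forall e, \tr (expmx (H + logmx (X + e%:C%:M))) = (g e)%:C.
  eexists => e; apply: mxtrace_expmx.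
  exact: hermsymmxD Hh (logmx_hermsymmx (X + e%:C%:M)).
have nondec e e' : 0 < e -> e <= e' -> g e <= g e'.
  move=> e0 ee'; rewrite -lecR -(gE e) -(gE e').
  have e'0 := lt_le_trans e0 ee'.
  apply: (trace_exp_add_log_le Hh (pdmx_psform_add Xpos e0) (pdmx_psform_add Xpos e'0)).
  have -> : X + e'%:C%:M - (X + e%:C%:M) = (e' - e)%:C%:M.
    by rewrite opprD addrACA subrr add0r rmorphB raddfB.
  by apply: psform_scalar; rewrite ler0c subr_ge0.
pose I : set R := `]0, 1[%classic.
have IE e : I e = (0 < e < 1) :> Prop.
  by rewrite /I set_itvoo.
have Ipos e : I e -> 0 < e by rewrite IE => /andP[].
have glb : lbound (g @` I)%classic b.
  by move=> _ [e /Ipos e0 <-]; rewrite -lecR -gE; exact: lb.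
have gcvg : (g x @[x --> 0^'+] --> inf (g @` I))%classic.
  apply: nondecreasing_at_right_cvgr; [by rewrite bnd_simp| |by exists b].
  by move=> e e'; rewrite in_itv/= => /andP[e0 _] _; exact: nondec.
exists (inf (g @` I)%classic)%:C; last first.
  rewrite lecR; apply: lb_le_inf => //.
  by exists (g 2^-1), 2^-1 => //; rewrite IE; apply/andP; split; lra.
rewrite /Tr_exp_add_log; under eq_fun do rewrite gE.
exact: (continuous_cvg _ (@real_complex_continuous R (inf (g @` I)%classic)) gcvg).
Qed.

End TraceInequality.

Local Open Scope complex_scope.

Theorem theorem1p2 (R : realType) (n m : nat)
    (Phi : {linear 'M[R[i]]_n -> 'M[R[i]]_m})
    (Phid : {linear 'M[R[i]]_m -> 'M[R[i]]_n})
    (Phi_unital : unital_map Phi) (Phi_positive : positive_map Phi)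
    (Phid_adjoint : is_HSadjoint Phi Phid)
    (H : 'M[R[i]]_n) (H_herm : H \is hermsymmx)
    (Y : 'M[R[i]]_m) (Y_pd : pdmx Y) :
  (pdmx (Phid Y) ->
     \tr (expmx (H + logmx (Phid Y))) >= \tr (expmx (Phi H + logmx Y)))
  /\ (exists2 t : R[i], Tr_exp_add_log H (Phid Y) t
        & t >= \tr (expmx (Phi H + logmx Y))).
Proof.
have Ypos : psform Y.
  split; first by case: Y_pd.
  move=> v; have [->|v0] := eqVneq v 0; first by rewrite /sform mulmx0 mxE.
  by apply: ltW; exact: (proj2 Y_pd).
(* Used with [X = Phid Y] for the first claim and with [X = Phid Y + e] for the limit. *)
have dom X : pdmx X -> psform (X - Phid Y) ->
    \tr (expmx (Phi H + logmx Y)) <= \tr (expmx (H + logmx X)).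
  move=> Xpd XY.
  apply: (trace_exp_le Phi_unital Phi_positive Phid_adjoint H_herm
    (logmx_hermsymmx X) (logmx_hermsymmx Y)).
  by rewrite (expmx_logmx Xpd) (expmx_logmx Y_pd).
split=> [Phid_pd|].
  apply: dom => //; rewrite subrr -[0](raddf0 (@scalar_mx _ n)).
  exact: psform_scalar.
have Xpos := adjoint_positive Phi_positive Phid_adjoint Ypos.
have Lh := hermsymmxD (positive_map_hermsymmx Phi_positive H_herm) (logmx_hermsymmx Y).
rewrite (mxtrace_expmx Lh); apply: trace_exp_add_log_cvg => // e e0.
rewrite -(mxtrace_expmx Lh); apply: dom; first exact: pdmx_psform_add.
by rewrite addrAC subrr add0r; apply: psform_scalar; rewrite ler0c ltW.
Qed.
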